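(* Let $n\ge 3$ and let $SF_n$ be the sunflower graph. Then $cn_{\chi}(SF_n)=n+1$ and $$cn^c_{\chi}(SF_n)=\begin{cases}\frac{(n+1)n^2}{4}, & n \text{ even},\\ \frac{(n+1)(n-1)^2}{4}, & n\text{ odd}.\end{cases}$$
   Context: All graphs are finite, simple, undirected and connected. A chromatic colouring of a graph $G$ is a proper vertex colouring with exactly $\chi(G)$ colours $c_1,\ldots,c_\ell$, $\ell=\chi(G)$; the colour class of $c_i$ is denoted $\mathcal{C}_i$ and $\theta(c_i)=|\mathcal{C}_i|$. A $\chi^-$-colouring of $G$ is a chromatic colouring in which the maximum possible number of vertices gets colour $c_1$, then (subject to that) the maximum possible number of the remaining vertices gets $c_2$, then the maximum possible number of the remaining vertices gets $c_3$, and so on; that is, $(\theta(c_1),\ldots,\theta(c_\ell))$ is lexicographically maximal among all chromatic colourings of $G$. With respect to a $\chi^-$-colouring, the chromatic curling number is $cn_{\chi}(G)=\max\{\theta(c_i):1\le i\le \ell\}$ and the chromatic compound curling number is $cn^c_{\chi}(G)=\prod_{i=1}^{\ell}\theta(c_i)$. The sunflower graph $SF_n$ (on $2n+1$ vertices) is obtained from the wheel with rim cycle $v_1v_2\cdots v_nv_1$ and central vertex $v$ (adjacent to all $v_i$) by replacing each rim edge by a triangle, two triangles sharing a vertex exactly when the corresponding rim edges are adjacent; i.e. for each rim edge $v_iv_{i+1}$ (indices mod $n$; the edge is kept) a new vertex $u_i$ adjacent to exactly $v_i$ and $v_{i+1}$ is added. *)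

(* Defs.v *)
From mathcomp Require Import all_boot all_order all_algebra.

Set Implicit Arguments.
Unset Strict Implicit.
Unset Printing Implicit Defensive.

Record sgraph := SGraph {
  vertex :> finType;
  adj : rel vertex;
  adj_sym : symmetric adj;
  adj_irr : irreflexive adj;
  adj_conn : forall x y, connect adj x y }.

Definition proper_colouring (G : sgraph) (k : nat) (f : {ffun G -> 'I_k}) : bool :=
  [forall x, forall y, adj x y ==> (f x != f y)].

Definition colourable (G : sgraph) (k : nat) : bool :=
  [exists f : {ffun G -> 'I_k}, proper_colouring f].

Lemma colourable_card (G : sgraph) : exists k, colourable G k.
Proof.
exists #|G|; apply/existsP; exists [ffun x => enum_rank x].
apply/forallP => x; apply/forallP => y; apply/implyP => xy.
rewrite !ffunE (inj_eq enum_rank_inj); apply/eqP => exy.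
by rewrite exy adj_irr in xy.
Qed.

Definition chromatic_number (G : sgraph) : nat := ex_minn (colourable_card G).

Definition theta (G : sgraph) (k : nat) (f : {ffun G -> 'I_k}) (c : 'I_k) : nat :=
  #|f @^-1: [set c]|.

Definition chromatic_colouring (G : sgraph)
    (f : {ffun G -> 'I_(chromatic_number G)}) : bool :=
  proper_colouring f && [forall c, 0 < theta f c].

(* The type [tuplelexi] carries the lexicographic order, first entry (the class
   of c_1) most significant. *)
Definition theta_lexi (G : sgraph) (k : nat) (f : {ffun G -> 'I_k}) :
    k.-tuplelexi nat :=
  [tuple theta f c | c < k].

(* Greedily maximizing theta(c_1), then theta(c_2), and so on, is maximizing
   the tuple of class sizes lexicographically. *)
Definition chi_minus_colouring (G : sgraph)
    (f : {ffun G -> 'I_(chromatic_number G)}) : bool :=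
  chromatic_colouring f &&
  [forall g : {ffun G -> 'I_(chromatic_number G)},
     chromatic_colouring g ==> (theta_lexi g <= theta_lexi f)%O].

Lemma ex_chromatic_colouring (G : sgraph) :
  exists f : {ffun G -> 'I_(chromatic_number G)}, chromatic_colouring f.
Proof.
rewrite /chromatic_colouring /chromatic_number.
case: ex_minnP => k /existsP[f fP] kmin; exists f; rewrite fP /=.
apply/forallP => c; rewrite lt0n; apply/negP; rewrite cards_eq0 => /eqP f0.
case: k f fP kmin c f0 => [|k] f fP kmin c f0; first by case: c f0.
have fc x : c != f x.
  apply/eqP => e; have: x \in f @^-1: [set c] by rewrite !inE -e.
  by rewrite f0 inE.
suff: colourable G k by move/kmin; rewrite ltnn.
apply/existsP; exists [ffun x => s2val (unlift_some (fc x))].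
apply/forallP => x; apply/forallP => y; apply/implyP => xy; rewrite !ffunE.
move/forallP/(_ x)/forallP/(_ y)/implyP/(_ xy): fP; apply: contra => /eqP e.
case: (unlift_some (fc x)) (unlift_some (fc y)) e => i ex _ [j ey _] /= e.
by rewrite ex ey e.
Qed.

Lemma ex_chi_minus_colouring (G : sgraph) :
  exists f : {ffun G -> 'I_(chromatic_number G)}, chi_minus_colouring f.
Proof.
have [f0 f0P] := ex_chromatic_colouring G.
case: (Order.TotalTheory.arg_maxP (@theta_lexi G _) f0P) => f fP fmax.
exists f; rewrite /chi_minus_colouring fP /=.
by apply/forallP => g; apply/implyP => /fmax.
Qed.

Definition chi_minus (G : sgraph) : {ffun G -> 'I_(chromatic_number G)} :=
  xchoose (ex_chi_minus_colouring G).

Definition chromatic_curling_number (G : sgraph) : nat :=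
  \max_(c < chromatic_number G) theta (chi_minus G) c.

Definition chromatic_compound_curling_number (G : sgraph) : nat :=
  \prod_(c < chromatic_number G) theta (chi_minus G) c.

(* The class sizes, hence the two numbers above, do not depend on which
   chi^- -colouring is chosen. *)
Lemma theta_chi_minus (G : sgraph) (f : {ffun G -> 'I_(chromatic_number G)}) :
  chi_minus_colouring f -> theta (chi_minus G) =1 theta f.
Proof.
move=> /andP[fP /forallP fmax].
have /andP[gP /forallP gmax] := xchooseP (ex_chi_minus_colouring G).
have /eqP e : theta_lexi (chi_minus G) == theta_lexi f.
  rewrite Order.POrderTheory.eq_le (implyP (fmax _) gP).
  exact: (implyP (gmax _) fP).
by move=> c; have := congr1 (fun t => tnth t c) e; rewrite !tnth_mktuple.
Qed.

(* [None] is the hub v, [Some (inl i)] the rim vertex v_i and [Some (inr i)]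
   the apex u_i over the rim edge v_i v_(i+1). *)
Definition sunflower_vertex (n : nat) : finType := option ('I_n + 'I_n)%type.

Definition sunflower_arc (n : nat) (x y : sunflower_vertex n) : bool :=
  match x, y with
  | None, Some (inl _) => true
  | Some (inl i), Some (inl j) => j == ordS i
  | Some (inr i), Some (inl j) => (j == i) || (j == ordS i)
  | _, _ => false
  end.

(* The guard [x != y] only matters for n = 1, where ordS has a fixed point. *)
Definition sunflower_adj (n : nat) : rel (sunflower_vertex n) :=
  fun x y => (x != y) && (sunflower_arc x y || sunflower_arc y x).

Lemma sunflower_sym (n : nat) : symmetric (@sunflower_adj n).
Proof. by move=> x y; rewrite /sunflower_adj eq_sym orbC. Qed.

Lemma sunflower_irr (n : nat) : irreflexive (@sunflower_adj n).
Proof. by move=> x; rewrite /sunflower_adj eqxx. Qed.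

Lemma sunflower_conn (n : nat) (x y : sunflower_vertex n) :
  connect (@sunflower_adj n) x y.
Proof.
have sym : connect_sym (@sunflower_adj n) by exact/sym_connect_sym/sunflower_sym.
have rim i : connect (@sunflower_adj n) None (Some (inl i)) by exact: connect1.
have hub z : connect (@sunflower_adj n) None z.
  case: z => [[i|i]|] //; apply: connect_trans (rim i) _.
  by apply: connect1; rewrite /sunflower_adj /= eqxx.
by apply: connect_trans (hub y); rewrite sym.
Qed.

Definition sunflower (n : nat) : sgraph :=
  SGraph (@sunflower_sym n) (@sunflower_irr n) (@sunflower_conn n).

(* Main.v *)
(* A colour class either contains the hub, and then only apexes besides it, or
   contains at most one vertex of each pair {v_i, u_i}; hence it has at most
   n + 1 vertices, with equality only for the hub together with all the apexes.
   A class meets the rim, a cycle, in at most n/2 (rounded down) vertices, and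
   the colour of the hub does not occur on the rim; so 3 colours are needed for
   even n and 4 for odd n.  The class sizes of a chromatic colouring are thus
   lexicographically at most (n + 1, n/2, n/2), followed by 1 when n is odd,
   since the last size is determined by the others; and this is attained. *)
Require Import Defs.
From mathcomp Require Import all_boot all_order all_algebra.
From mathcomp Require Import zify ring.
Import GRing.Theory.

Set Implicit Arguments.
Unset Strict Implicit.
Unset Printing Implicit Defensive.

(** * Class sizes and lexicographic maximality in a general graph *)

Lemma sum_card_fibre (T : finType) (k : nat) (h : T -> 'I_k) :
  \sum_(c < k) #|[set x | h x == c]| = #|T|.
Proof.
rewrite -sum1_card (partition_big h predT) //=.
by apply: eq_bigr => c _; rewrite sum1dep_card.
Qed.

Lemma sum_theta (G : sgraph) (k : nat) (f : {ffun G -> 'I_k}) :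
  \sum_(c < k) theta f c = #|G|.
Proof.
rewrite -(sum_card_fibre f); apply: eq_bigr => c _.
by congr #|pred_of_set _|; apply/setP => x; rewrite !inE.
Qed.

Lemma chromatic_numberE (G : sgraph) (k : nat) :
  colourable G k -> (forall j, colourable G j -> k <= j) ->
  chromatic_number G = k.
Proof.
move=> col_k min_k; rewrite /chromatic_number; case: ex_minnP => m col_m min_m.
by apply/anti_leq; rewrite min_m //= min_k.
Qed.

(** The first differing entry decides the lexicographic order, so a class has to be compared only
    when all earlier sizes agree. *)
Lemma theta_lexi_le (G : sgraph) (k : nat) (f g : {ffun G -> 'I_k}) :
  (forall c : 'I_k, (forall d : 'I_k, d < c -> theta g d = theta f d) ->
     theta g c <= theta f c) ->
  (theta_lexi g <= theta_lexi f)%O.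
Proof.
move=> le_gf; rewrite Order.TotalTheory.leNgt; apply/negP.
case/Order.TupleLexiOrder.ltxi_tuplePlt => c eq_lt.
rewrite !tnth_mktuple => lt_c.
suff: theta g c <= theta f c by rewrite leqNgt => /negP; apply.
apply: le_gf => d /eq_lt.
by rewrite !tnth_mktuple.
Qed.

(** The variable [k] lets an explicit colouring into a known number of colours be used without a
    cast to ['I_(chromatic_number G)]. *)
Lemma curling_lexi_max (G : sgraph) (k : nat) (f : {ffun G -> 'I_k}) :
  chromatic_number G = k -> proper_colouring f -> (forall c, 0 < theta f c) ->
  (forall g : {ffun G -> 'I_k}, proper_colouring g ->
     (theta_lexi g <= theta_lexi f)%O) ->
  chromatic_curling_number G = \max_(c < k) theta f c /\
  chromatic_compound_curling_number G = \prod_(c < k) theta f c.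
Proof.
move=> ek; subst k => f_proper f_pos f_max.
have fP : chi_minus_colouring f.
  rewrite /chi_minus_colouring /chromatic_colouring f_proper.
  apply/andP; split; first exact/forallP.
  by apply/forallP => g; apply/implyP => /andP[/f_max].
by split; apply: eq_bigr => c _; rewrite (theta_chi_minus fP).
Qed.

(** [A] is disjoint from its successor set, which has the same size because [ordS] is injective. *)
Lemma card_cycle_indep (n : nat) (A : {set 'I_n}) :
  (forall i, i \in A -> ordS i \notin A) -> #|A| <= n./2.
Proof.
move=> indepA.
have disjA : [disjoint A & @ordS n @: A].
  rewrite disjoint_sym disjoints_subset; apply/subsetP => _ /imsetP[i iA ->].
  by rewrite inE indepA.
have : #|A| + #|@ordS n @: A| <= n.
  have := max_card (mem (A :|: @ordS n @: A)).
  by rewrite cardsU disjoint_setI0 // cards0 subn0 card_ord.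
rewrite card_imset; last exact: ordS_inj.
by rewrite addnn => /half_leq; rewrite doubleK.
Qed.

(** * Bounds valid for every proper colouring of the sunflower *)

Section Sunflower.

Variables (n k : nat) (g : {ffun sunflower n -> 'I_k}).

Definition rim_class (c : 'I_k) : {set 'I_n} := [set i | g (Some (inl i)) == c].
Definition apex_class (c : 'I_k) : {set 'I_n} := [set i | g (Some (inr i)) == c].

Lemma theta_sunflower (c : 'I_k) :
  theta g c = (g None == c) + #|rim_class c| + #|apex_class c|.
Proof.
rewrite /theta -sum1_card (eq_bigl (fun x => g x == c)); last first.
  by move=> x; rewrite !inE.
rewrite big_mkcond (bigD1 None) //= -addnA; congr (_ + _).
rewrite (reindex_omap (op := addn) Some id) /=; last by case.
rewrite (eq_bigl predT); last by move=> x; rewrite eqxx.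
by rewrite big_sumType /= -!big_mkcond !sum1dep_card.
Qed.

Hypotheses (hn : 1 < n) (g_proper : proper_colouring g).

Lemma sunflower_arc_neq (x y : sunflower_vertex n) :
  x != y -> sunflower_arc x y -> g x != g y.
Proof.
move=> neq_xy arc_xy; apply: (implyP (forallP (forallP g_proper x) y)).
by rewrite /= /sunflower_adj neq_xy arc_xy.
Qed.

Lemma hub_rim_neq (i : 'I_n) : g None != g (Some (inl i)).
Proof. exact: sunflower_arc_neq. Qed.

Lemma apex_rim_neq (i : 'I_n) : g (Some (inr i)) != g (Some (inl i)).
Proof. by apply: sunflower_arc_neq => //=; rewrite eqxx. Qed.

Lemma ordS_neq (i : 'I_n) : i != ordS i.
Proof.
apply/eqP => /(congr1 val) /= ei.
have := ltn_ord i; rewrite leq_eqVlt => /orP[/eqP e|lt]; last first.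
  by rewrite modn_small // in ei; lia.
by rewrite e modnn in ei; lia.
Qed.

Lemma card_rim_class (c : 'I_k) : #|rim_class c| <= n./2.
Proof.
apply: card_cycle_indep => i; rewrite !inE => /eqP <-; rewrite eq_sym.
apply: sunflower_arc_neq => /=; last exact: eqxx.
by apply/eqP => -[/eqP]; rewrite (negbTE (ordS_neq i)).
Qed.

Lemma rim_class_hub : rim_class (g None) = set0.
Proof.
by apply/setP => i; rewrite !inE eq_sym (negbTE (hub_rim_neq i)).
Qed.

Lemma card_rim_apex_class (c : 'I_k) : #|rim_class c| + #|apex_class c| <= n.
Proof.
have -> : #|rim_class c| + #|apex_class c| = #|rim_class c :|: apex_class c|.
  rewrite cardsU disjoint_setI0 ?cards0 ?subn0 // disjoints_subset.
  apply/subsetP => i; rewrite !inE => /eqP <-; exact: apex_rim_neq.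
by rewrite -[leqRHS]card_ord max_card.
Qed.

Lemma theta_sunflower_le (c : 'I_k) : theta g c <= n.+1.
Proof.
have := card_rim_apex_class c; rewrite theta_sunflower.
by case: (_ == _) => /=; lia.
Qed.

(* A class of size n + 1 must consist of the hub and all the apexes, so the
   other classes lie on the rim. *)
Lemma theta_sunflower_full (c d : 'I_k) :
  theta g c = n.+1 -> d != c -> theta g d <= n./2.
Proof.
rewrite !theta_sunflower => full neq_dc.
have := card_rim_apex_class c; have := card_rim_class d.
(* Without the hub, the bound on the pairs v_i, u_i leaves at most [n] vertices in the class. *)
have hub_c : g None = c.
  apply/eqP/negPn/negP => neq; rewrite (negbTE neq) in full.
  by have := card_rim_apex_class c; lia.
move: full; rewrite -hub_c eqxx rim_class_hub cards0 => full.
(* The hub's class already contains all [n] apexes, so this forces [apex_class d] to be empty. *)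
have : #|apex_class (g None)| + #|apex_class d| <= n.
  rewrite -[leqRHS]card_ord -(sum_card_fibre (fun i => g (Some (inr i)))).
  rewrite (bigD1 (g None)) //= leq_add2l (bigD1 d) ?leq_addr //=.
  by rewrite hub_c.
rewrite hub_c eq_sym (negbTE neq_dc); move: full; rewrite hub_c; lia.
Qed.

(* The hub's colour is missing from the rim, leaving k - 1 colours for it. *)
Lemma sunflower_rim_count : n <= k.-1 * n./2.
Proof.
rewrite -{1}[n]card_ord -(sum_card_fibre (fun i => g (Some (inl i)))).
rewrite (bigD1 (g None)) //= -/(rim_class _) rim_class_hub cards0 add0n.
apply: (@leq_trans (\sum_(c < k | c != g None) n./2)).
  by apply: leq_sum => c _; apply: card_rim_class.
by rewrite sum_nat_const cardC1 card_ord.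
Qed.

End Sunflower.

(* The hub and the apexes get 0; the rim alternates 1, 2, except that for odd n
   its last vertex gets the extra colour 3. *)
Definition opt_colour (n : nat) (x : sunflower_vertex n) : nat :=
  match x with
  | Some (inl i) => if odd n && (i == n.-1 :> nat) then 3 else (odd i).+1
  | _ => 0
  end.

Definition opt_colouring (n : nat) : {ffun sunflower n -> 'I_(2 + odd n).+1} :=
  [ffun x => inord (opt_colour x)].

(** Serves to find the rim class sizes without counting parities, with [b] as [odd n] and [m] as
    [n./2]: classes 1 and 2 together have [m.*2] vertices and each has at most [m], so both have
    exactly [m]. *)
Lemma four_sizes_extremal (b : bool) (m : nat) (r : 'I_(2 + b).+1 -> nat) :
  (forall c, r c <= m) -> (forall c : 'I__, c = 0 :> nat -> r c = 0) ->
  (forall c : 'I__, c = 3 :> nat -> r c = 1) ->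
  \sum_(c < (2 + b).+1) r c = b + m.*2 ->
  forall c : 'I__, r c = nth 0 [:: 0; m; m; 1] c.
Proof.
pose s j := r (inord j); have rE c : r c = s c by rewrite /s inord_val.
move=> le_m r0 r3.
rewrite (eq_bigr (fun c => s (val c))) => [|c _]; last exact: rE.
have s0 : s 0 = 0 by rewrite /s r0 // inordK.
have [s1 s2] : s 1 <= m /\ s 2 <= m by split; apply: le_m.
have s3 : b -> s 3 = 1 by move=> bT; rewrite /s r3 // inordK // bT.
have eq_m : \sum_(c < (2 + b).+1) s c = b + m.*2 -> s 1 = m /\ s 2 = m.
  by case: (b) s3 => [/(_ isT)|_]; rewrite !big_ord_recl big_ord0 /= !addn0;
    rewrite /= /bump !add1n; lia.
move=> /eq_m[e1 e2] c; rewrite rE.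
case: c => -[|[|[|[|j]]]] //= lt_c; first by apply: s3; case: (b) lt_c.
by case: (b) lt_c.
Qed.

(** * Class sizes and optimality of the explicit colouring *)

Section OptimalColouring.

Variables (n : nat) (hn : 2 < n).

Lemma val_opt_colouring (x : sunflower_vertex n) :
  opt_colouring n x = opt_colour x :> nat.
Proof.
rewrite ffunE inordK //; case: x => [[i|i]|] //=.
by case: (odd n) => /=; do ?case: ifP => // _; case: (odd i).
Qed.

Lemma opt_colour_arc (x y : sunflower_vertex n) :
  sunflower_arc x y -> opt_colour x != opt_colour y.
Proof.
case: x y => [[i|i]|] [[j|j]|] //=; try by case: ifP.
(* Only rim edges remain. The edge closing the cycle comes first: it joins colour 3 ([n] odd) or 2
   ([n] even) to colour 1. *)
move=> /eqP -> /=; have := ltn_ord i; rewrite leq_eqVlt => /orP[/eqP e|lt].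
  rewrite e modnn; have -> : (i == n.-1 :> nat) by lia.
  have -> : (0 == n.-1) = false by lia.
  rewrite andbT andbF; case: ifP => //= odd_n.
  by have -> : odd i by lia.
rewrite modn_small //; have -> : (i == n.-1 :> nat) = false by lia.
by rewrite andbF /=; case: ifP => //=; case: (odd i).
Qed.

Lemma opt_colouring_proper : proper_colouring (opt_colouring n).
Proof.
apply/forallP => x; apply/forallP => y; apply/implyP => /andP[_ arc_xy].
rewrite -val_eqE /= !val_opt_colouring.
by case/orP: arc_xy => /opt_colour_arc //; rewrite eq_sym.
Qed.

Lemma theta_opt_colouring (c : 'I_(2 + odd n).+1) :
  theta (opt_colouring n) c = nth 0 [:: n.+1; n./2; n./2; 1] c.
Proof.
have rimE d : #|rim_class (opt_colouring n) d| = nth 0 [:: 0; n./2; n./2; 1] d.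
  have rim_le := card_rim_class (ltnW hn) opt_colouring_proper.
  have rim0 (e : 'I_(2 + odd n).+1) : e = 0 :> nat ->
      #|rim_class (opt_colouring n) e| = 0.
    move=> e0; apply/eqP; rewrite cards_eq0 -subset0; apply/subsetP => i.
    rewrite !inE -val_eqE /= val_opt_colouring /= e0.
    by case: ifP.
  have rim3 (e : 'I_(2 + odd n).+1) : e = 3 :> nat ->
      #|rim_class (opt_colouring n) e| = 1.
    move=> e3; have odd_n : odd n.
      by have := ltn_ord e; rewrite e3; case: (odd n).
    have lt_n : n.-1 < n by lia.
    apply/eqP/cards1P; exists (Ordinal lt_n); apply/setP => i.
    rewrite !inE -!val_eqE /= val_opt_colouring /= e3 odd_n /=.
    by case: ifP => // _; case: (odd i).
  apply: (four_sizes_extremal rim_le rim0 rim3).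
  rewrite odd_double_half -[RHS]card_ord.
  exact: (sum_card_fibre (fun i => opt_colouring n (Some (inl i)))).
rewrite theta_sunflower rimE -val_eqE /= val_opt_colouring /=.
have -> : #|apex_class (opt_colouring n) c| = (c == ord0) * n.
  case: (eqVneq c ord0) => [->|c0].
    rewrite mul1n -[RHS]card_ord -cardsT; congr #|pred_of_set _|.
    by apply/setP => i; rewrite !inE -val_eqE /= val_opt_colouring.
  apply/eqP; rewrite cards_eq0 -subset0; apply/subsetP => i.
  rewrite !inE -val_eqE /= val_opt_colouring /= eq_sym => e0.
  by rewrite -val_eqE /= e0 in c0.
case: c => -[|m] lt_m /=; first by rewrite addn0 mul1n.
by rewrite mul0n addn0 add0n.
Qed.

Lemma chromatic_number_sunflower :
  chromatic_number (sunflower n) = (2 + odd n).+1.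
Proof.
apply: chromatic_numberE => [|j /existsP[g]].
  by apply/existsP; exists (opt_colouring n); exact: opt_colouring_proper.
move=> /(sunflower_rim_count (ltnW hn)) le_n.
(* With at most [2 + odd n] colours, the rim would have at most [(1 + odd n) * n./2] vertices, which
   is less than [n] for either parity. *)
rewrite ltnNge; apply/negP => le_j.
have := leq_mul (leq_sub2r 1 le_j) (leqnn n./2).
rewrite !subn1; have := odd_double_half n; case: (odd n) => /=; nia.
Qed.

Lemma opt_colouring_max (g : {ffun sunflower n -> 'I_(2 + odd n).+1}) :
  proper_colouring g -> (theta_lexi g <= theta_lexi (opt_colouring n))%O.
Proof.
move=> g_proper; apply: theta_lexi_le => c eq_lt.
have [c0|c_gt0] := posnP c.
  rewrite theta_opt_colouring c0 /=.
  exact: (theta_sunflower_le (ltnW hn) g_proper).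
have [c_lt3|c_ge3] := ltnP c 3.
  have -> : theta (opt_colouring n) c = n./2.
    rewrite theta_opt_colouring.
    by case: (nat_of_ord c) c_gt0 c_lt3 => [|[|[]]].
  (* Agreement on colour 0 gives [g] a class of size [n.+1], which confines the others. *)
  apply: (theta_sunflower_full (ltnW hn) g_proper (c := ord0)).
    by rewrite eq_lt // theta_opt_colouring.
  by rewrite -val_eqE /= -lt0n.
(* Colour 3 is the last one, so its class size is the total minus the earlier, equal sizes. *)
have := sum_theta g; rewrite -(sum_theta (opt_colouring n)).
rewrite (bigD1 c) //= [in RHS](bigD1 c) //=.
rewrite (eq_bigr (theta (opt_colouring n))) => [/addIn -> //|d neq_dc].
apply: eq_lt; move: neq_dc; rewrite -val_eqE /=.
by have := ltn_ord d; have := leq_b1 (odd n); lia.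
Qed.

Lemma sunflower_curling :
  chromatic_curling_number (sunflower n) = n.+1 /\
  chromatic_compound_curling_number (sunflower n) = n.+1 * n./2 ^ 2.
Proof.
have [c|g|-> ->] := curling_lexi_max chromatic_number_sunflower
  opt_colouring_proper; last 1 first.
- rewrite !(eq_bigr _ (fun c _ => theta_opt_colouring c)).
  by case: (odd n); rewrite !big_ord_recl !big_ord0 /=; split; lia.
- rewrite theta_opt_colouring.
  by case: c => -[|[|[|[|m]]]] //=; lia.
- exact: (@opt_colouring_max g).
Qed.

End OptimalColouring.

Local Open Scope ring_scope.

Theorem theorem8 (n : nat) (hn : (3 <= n)%N) :
  chromatic_curling_number (sunflower n) = n.+1 /\
  (chromatic_compound_curling_number (sunflower n))%:R =
    (if ~~ odd n then ((n%:R + 1) * n%:R ^+ 2) / 4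
     else ((n%:R + 1) * (n%:R - 1) ^+ 2) / 4) :> rat.
Proof.
have [-> ->] := sunflower_curling hn; split=> //.
(* Writing [n] through [n./2] turns both parities into polynomial identities. *)
have en : n%:R = (odd n)%:R + 2 * n./2%:R :> rat.
  by rewrite -[in LHS](odd_double_half n) natrD -muln2 natrM mulrC.
rewrite natrM natrX -natr1.
by case: (odd n) en => /= en; rewrite en; field.
Qed.
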